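(* Let $a$ be a weak composition with exactly two nonzero parts and no leading zero (that is, $a_1\neq 0$). Then $\kappa_a$ is multiplicity free.
   Context: A weak composition $a=(a_1,\dots,a_\ell)$ of length $\ell$ is a finite sequence of nonnegative integers. A diagram is a finite set of cells $(r,c)$ with $r,c$ positive integers (row $r$ from the bottom, column $c$ from the left). A Kohnert tableau of content $a$ is a diagram filled with positive integers, exactly $a_i$ cells containing $i$ for each $i$, such that: (i) for each $i$ there is exactly one $i$ in each of the columns $1,\dots,a_i$; (ii) every entry in row $r$ is at least $r$; (iii) for each $i$, the cells containing $i$ weakly descend from left to right; (iv) if $i<j$ appear in the same column with $i$ above $j$, then there is an $i$ in the column immediately to the right of the cell containing that $j$, in a row strictly above it. It is quasi-Yamanouchi if moreover (v) for each nonempty row $r$, either row $r$ contains an entry equal to $r$, or some cell of row $r+1$ lies weakly to the right of some cell of row $r$. Let $\mathrm{QKT}(a)$ be the set of quasi-Yamanouchi Kohnert tableaux of content $a$, and $\mathrm{wt}(T)$ the weak composition of length $\ell$ whose $r$-th part is the number of cells in row $r$ of $T$. The key polynomial $\kappa_a$ satisfies $\kappa_a=\sum_{T\in\mathrm{QKT}(a)}\mathfrak{F}_{\mathrm{wt}(T)}$, where $\mathfrak{F}_b$ is the fundamental slide polynomial. We say $\kappa_a$ is multiplicity free if distinct tableaux in $\mathrm{QKT}(a)$ have distinct weights. *)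

(* Defs.v *)
From mathcomp Require Import all_boot finmap.

Set Implicit Arguments.
Unset Strict Implicit.
Unset Printing Implicit Defensive.

Local Open Scope fset_scope.
Local Open Scope fmap_scope.

Definition weak_composition := seq nat.

(* Parts are numbered from 1; parts beyond the length are 0. The value at
   i = 0 is junk, and every use below has 0 < i. *)
Definition part (a : weak_composition) (i : nat) : nat := nth 0 a i.-1.

(* A cell (r, c) lies in row r (from the bottom) and column c (from the left).
   The domain of a filling is its underlying diagram, so that equality of
   fillings is equality of the diagrams together with all the entries. *)
Definition filling := {fmap nat * nat -> nat}.

Definition entry (T : filling) (r c i : nat) : Prop := T.[? (r, c)] = Some i.

Definition positive_filling (T : filling) : Prop :=
  forall r c i, entry T r c i -> [/\ 0 < r, 0 < c & 0 < i].

Definition has_content (a : weak_composition) (T : filling) : Prop :=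
  forall i, 0 < i ->
    #|` [fset x in domf T | T.[? x] == Some i]| = part a i.

Record Kohnert_tableau (a : weak_composition) (T : filling) : Prop := {
  KT_positive : positive_filling T;
  KT_content : has_content a T;
  KT_columns : forall i c, 0 < i -> 0 < c <= part a i ->
    exists! r, entry T r c i;
  KT_flagged : forall r c i, entry T r c i -> r <= i;
  KT_descend : forall i r1 c1 r2 c2,
    entry T r1 c1 i -> entry T r2 c2 i -> c1 < c2 -> r2 <= r1;
  KT_inversion : forall i j c r s,
    i < j -> entry T r c i -> entry T s c j -> s < r ->
    exists2 t, s < t & entry T t c.+1 i
}.

Definition quasi_Yamanouchi (T : filling) : Prop :=
  forall r, (exists c, (r, c) \in domf T) ->
    (exists c, entry T r c r) \/
    (exists c c', [/\ (r, c) \in domf T, (r.+1, c') \in domf T & c <= c']).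

Definition QKT (a : weak_composition) (T : filling) : Prop :=
  Kohnert_tableau a T /\ quasi_Yamanouchi T.

(* Item k of a mkseq is its (k + 1)-st part. *)
Definition wt (a : weak_composition) (T : filling) : weak_composition :=
  mkseq (fun k => #|` [fset x in domf T | x.1 == k.+1]|) (size a).

(* The key polynomial of a is the sum over T in QKT a of the fundamental slide
   polynomials indexed by wt a T; multiplicity freeness of the key polynomial
   is by definition a condition on these tableaux. *)
Definition key_multiplicity_free (a : weak_composition) : Prop :=
  forall T U : filling, QKT a T -> QKT a U -> T <> U -> wt a T <> wt a U.

(* Main.v *)
(** Write the nonzero parts as a_1 and a_n with n > 1. All entries 1 lie in
    row 1. A nonempty row r with 1 < r < n would contain only entries n, and
    since these descend from left to right, one per column, row r + 1 has no
    cell weakly to the right of a cell of row r; this contradicts the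
    quasi-Yamanouchi condition. Hence every n lies in row 1 or in row n, the
    ones in row n forming an initial segment, so the tableau is determined by
    the number of cells in row n. *)

Require Import Defs.
From mathcomp Require Import all_boot finmap.

Set Implicit Arguments.
Unset Strict Implicit.
Unset Printing Implicit Defensive.

Local Open Scope fset_scope.
Local Open Scope fmap_scope.

Lemma two_nonzero_parts (a : weak_composition) :
  count (fun p => p != 0) a = 2 -> part a 1 != 0 ->
  exists n, [/\ 1 < n, n <= size a &
    forall i, 0 < i -> part a i != 0 -> i = 1 \/ i = n].
Proof.
case: a => [|x a] //= + x0; rewrite /part /= in x0; rewrite x0 add1n => -[ca].
have ha : has (fun p => p != 0) a by rewrite has_count ca.
(* The search runs over the tail from index 0, while parts are numbered from 1: hence the shift by
   two. *)
exists (find (fun p => p != 0) a).+2; split=> //; first by rewrite /= ltnS -has_find.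
case=> [|[|i]] //= _ ai; [by left | right; congr _.+2].
rewrite /part /= in ai.
(* The tail has a single nonzero item, so any index holding a nonzero value is the one that [find]
   returns. *)
elim: a i ca ai {ha} => [|y a IH] i /=; first by [].
case: (y =P 0) => [->|y0] /=.
  by case: i => [|i] //= ca ai; congr _.+1; apply: IH.
rewrite add1n => -[ca]; case: i => [|i] //= ai.
have ia : i < size a by rewrite ltnNge; apply: contra ai => /(nth_default 0) ->.
suff : has (fun p => p != 0) a by rewrite has_count ca.
by apply/(has_nthP 0); exists i.
Qed.

Lemma domf_entry (T : filling) r c :
  (r, c) \in domf T -> exists i, entry T r c i.
Proof. by move=> rcT; exists T.[rcT]; rewrite /entry in_fnd. Qed.

Lemma entry_domf (T : filling) r c i : entry T r c i -> (r, c) \in domf T.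
Proof. by move=> e; rewrite -fndSome e. Qed.

Section KohnertTableau.

Variables (a : weak_composition) (T : filling).
Hypothesis KT : Kohnert_tableau a T.

(** By counting: the columns [C] met by the entries [i] include all of [1, ..., part a i], and there
    are only [part a i] such entries, so no other column is met. *)
Lemma KT_column_bound r c i : entry T r c i -> 0 < c <= part a i.
Proof.
move=> e; have [_ _ i0] := KT_positive KT e.
pose S := [fset x in domf T | T.[? x] == Some i].
pose C := [fset x.2 | x in S].
pose I := seq_fset tt (iota 1 (part a i)).
have cI : #|` I| = part a i.
  by rewrite size_seq_fset undup_id ?iota_uniq // size_iota.
have IC : I `<=` C.
  apply/fsubsetP => k; rewrite seq_fsetE mem_iota add1n ltnS => hk.
  have [s [es _]] := KT_columns KT i0 hk.
  apply/imfsetP; exists (s, k) => //=.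
  by rewrite !inE /= (entry_domf es) /=; apply/eqP.
have CI : I = C.
  apply/eqP; rewrite eqEfcard IC cI -(KT_content KT i0).
  exact: leq_imfset_card.
have : c \in C.
  apply/imfsetP; exists (r, c) => //=.
  by rewrite !inE /= (entry_domf e) /=; apply/eqP.
by rewrite -CI seq_fsetE mem_iota add1n ltnS.
Qed.

Lemma KT_column_uniq r s c i : entry T r c i -> entry T s c i -> r = s.
Proof.
move=> er es; have [_ _ i0] := KT_positive KT er.
have [t [_ tU]] := KT_columns KT i0 (KT_column_bound er).
by rewrite -(tU _ er) -(tU _ es).
Qed.

Lemma KT_weakly_descend i r1 c1 r2 c2 :
  entry T r1 c1 i -> entry T r2 c2 i -> c1 <= c2 -> r2 <= r1.
Proof.
move=> e1 e2; rewrite leq_eqVlt => /orP[/eqP c12|]; last exact: KT_descend KT _ _ _ _ _ e1 e2.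
by rewrite -c12 in e2; rewrite (KT_column_uniq e1 e2).
Qed.

Lemma KT_entry1 r c : entry T r c 1 -> r = 1.
Proof.
move=> e; have [r0 _ _] := KT_positive KT e.
by apply/eqP; rewrite eqn_leq r0 (KT_flagged KT e).
Qed.

Lemma KT_entry_part r c i : entry T r c i -> part a i != 0.
Proof. by move/KT_column_bound => /andP[c0 cp]; rewrite -lt0n (leq_trans c0). Qed.

End KohnertTableau.

Lemma KT_same_column (a : weak_composition) (T U : filling) r c i :
  Kohnert_tableau a T -> Kohnert_tableau a U -> entry T r c i ->
  exists s, entry U s c i.
Proof.
move=> KT KU e; have [_ _ i0] := KT_positive KT e.
by have [s [es _]] := KT_columns KU i0 (KT_column_bound KT e); exists s.
Qed.

Section TwoParts.

Variables (a : weak_composition) (n : nat).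
Hypothesis n_gt1 : 1 < n.
Hypothesis n_le_size : n <= size a.
Hypothesis parts : forall i, 0 < i -> part a i != 0 -> i = 1 \/ i = n.

Lemma KT_entries (T : filling) r c i :
  Kohnert_tableau a T -> entry T r c i -> i = 1 \/ i = n.
Proof.
move=> KT e; have [_ _ i0] := KT_positive KT e.
exact: parts (KT_entry_part KT e).
Qed.

Lemma KT_upper_row_entry (T : filling) r c :
  Kohnert_tableau a T -> 1 < r -> (r, c) \in domf T -> entry T r c n.
Proof.
move=> KT r1 /domf_entry[i e]; case: (KT_entries KT e) => ei; subst i => //.
by rewrite (KT_entry1 KT e) in r1.
Qed.

Lemma QKT_rows (T : filling) r c : QKT a T -> entry T r c n -> r = 1 \/ r = n.
Proof.
move=> [KT QT] e; have [r0 _ _] := KT_positive KT e.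
have [/eqP ->|r_neq1] := boolP (r == 1); first by left.
have r1 : 1 < r by rewrite ltn_neqAle eq_sym r_neq1.
case: (QT r); first by exists c; apply: entry_domf e.
  by case=> c' /(KT_entries KT) [] ?; [left | right].
case=> c1 [c2 [d1 d2 c12]].
have e1 := KT_upper_row_entry KT r1 d1.
have e2 := KT_upper_row_entry KT (ltnW r1 : 1 < r.+1) d2.
by have := KT_weakly_descend KT e1 e2 c12; rewrite ltnn.
Qed.

(** Row [n] of [U] is a proper subset of row [n] of [T], the cell [(n, c)] being the difference. *)
Lemma QKT_row_card_lt (T U : filling) c :
  QKT a T -> QKT a U -> entry T n c n -> entry U 1 c n ->
  #|` [fset x in domf U | x.1 == n]| < #|` [fset x in domf T | x.1 == n]|.
Proof.
move=> [KT _] [KU _] eT eU.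
(* In [U] the entries [n] have come down to row 1 by column [c] and cannot rise again. *)
have left_of d : (n, d) \in domf U -> d < c.
  move/(KT_upper_row_entry KU n_gt1) => e; rewrite ltnNge; apply/negP => cd.
  by have := leq_trans n_gt1 (KT_weakly_descend KU eU e cd).
apply/fproper_ltn_card; rewrite fproperEneq andbC; apply/andP; split.
  apply/fsubsetP => -[r d].
  rewrite !inE /= => /andP[rdU /eqP ?]; subst r; rewrite eqxx andbT.
  (* The [n] of [T] in column [d] is left of [(n, c)], so descent puts it in row [n] or higher, and
     the flag condition in row [n] or lower. *)
  have [s es] := KT_same_column KU KT (KT_upper_row_entry KU n_gt1 rdU).
  have ns := KT_weakly_descend KT es eT (ltnW (left_of d rdU)).
  suff <- : s = n by apply: entry_domf es.
  by apply/eqP; rewrite eqn_leq ns (KT_flagged KT es).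
apply/eqP => /fsetP/(_ (n, c)); rewrite !inE /= (entry_domf eT) eqxx andbT.
by move/left_of; rewrite ltnn.
Qed.

Lemma wt_row_card (T U : filling) : wt a T = wt a U ->
  #|` [fset x in domf T | x.1 == n]| = #|` [fset x in domf U | x.1 == n]|.
Proof.
move/(congr1 (fun w => nth 0 w n.-1)).
(* Row [n] is counted at index [n.-1], which is in range since [n <= size a]. *)
by have n0 := ltnW n_gt1; rewrite !nth_mkseq ?prednK.
Qed.

Lemma QKT_wt_entry (T U : filling) r c i :
  QKT a T -> QKT a U -> wt a T = wt a U -> entry T r c i -> entry U r c i.
Proof.
move=> QT QU wtE e; have [[KT _] [KU _]] := (QT, QU).
have [s es] := KT_same_column KT KU e.
suff -> : r = s by [].
have cardE := wt_row_card wtE.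
case: (KT_entries KT e) => ei; subst i.
  by rewrite (KT_entry1 KT e) (KT_entry1 KU es).
(* If the rows differ, one is 1 and the other [n], and the counts in row [n] would differ. *)
case: (QKT_rows QT e) (QKT_rows QU es) => ? [] ?; subst r s => //.
  by have := QKT_row_card_lt QU QT es e; rewrite cardE ltnn.
by have := QKT_row_card_lt QT QU e es; rewrite cardE ltnn.
Qed.

End TwoParts.

Theorem theorem5p7 (a : weak_composition)
  (two_parts : count (fun p => p != 0) a = 2)
  (no_leading_zero : part a 1 != 0) :
  key_multiplicity_free a.
Proof.
have [n [n1 na parts]] := two_nonzero_parts two_parts no_leading_zero.
move=> T U QT QU TU wtE; apply: TU; apply/fmapP => -[r c].
case ET: T.[? (r, c)] => [i|]; first by rewrite (QKT_wt_entry n1 na parts QT QU wtE ET).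
(* A cell outside [T] must also be shown to lie outside [U], by exchanging the two tableaux. *)
case EU: U.[? (r, c)] => [i|] //.
by have := QKT_wt_entry n1 na parts QU QT (esym wtE) EU; rewrite /entry ET.
Qed.
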